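(* Let $\kappa$ and $\lambda$ be infinite cardinals such that the partition relation $\kappa^+\rightarrow[\lambda^+]^2_{\kappa,\lambda}$ holds. Then ${\sf BC}_\lambda$ implies ${\sf BC}_\kappa$, and ${\sf BC}({}^\lambda2,\lambda)$ implies ${\sf BC}({}^\kappa2,\kappa)$.
   Context: $\kappa^+\rightarrow[\lambda^+]^2_{\kappa,\lambda}$ means: for every function $f:[\kappa^+]^2\to\kappa$ (from the 2-element subsets of $\kappa^+$) there is $X\subseteq\kappa^+$ with $|X|=\lambda^+$ and $|\{f(Y):Y\in[X]^2\}|\le\lambda$. All topological groups are assumed Tychonoff. A topological group $(G,* )$ is $\aleph_0$-bounded if for every open neighborhood $U$ of the identity countably many translates of $U$ cover $G$. A subset $X$ of $G$ is Rothberger bounded if for every sequence $(U_n:n<\omega)$ of open neighborhoods of the identity there are $g_n\in G$ with $X\subseteq\bigcup_n g_n*U_n$. For infinite $\theta$, ${\sf BC}_\theta$: every Rothberger bounded subset of an $\aleph_0$-bounded topological group of weight $\theta$ has cardinality at most $\theta$; ${\sf BC}({}^\theta2,\theta)$: every Rothberger bounded subset of the group ${}^\theta2$ (functions $\theta\to\{0,1\}$, coordinatewise addition mod 2, product topology) has cardinality at most $\theta$. *)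

(* Defs.v *)
From HB Require Import structures.
From mathcomp Require Import all_boot all_order all_algebra.
From mathcomp Require Import all_classical all_reals all_analysis.
From mathcomp Require Import Rstruct Rstruct_topology.
From Stdlib Require Import Rdefinitions.

Set Implicit Arguments.
Unset Strict Implicit.
Unset Printing Implicit Defensive.

Local Open Scope classical_set_scope.
Local Open Scope card_scope.

Definition is_succ_card (K Kp : Type) : Prop :=
  [set: K] #<= [set: Kp] /\ ~ ([set: Kp] #<= [set: K]) /\
  forall Y : Type, [set: K] #<= [set: Y] -> ~ ([set: Y] #<= [set: K]) ->
    [set: Kp] #<= [set: Y].

Definition two_subsets (T : Type) (X : set T) : set (set T) :=
  [set Y | exists x y, x <> y /\ X x /\ X y /\ Y = [set x; y]].

(* kappa^+ -> [lambda^+]^2_{kappa, lambda}, with K, Kp, L, Lp types of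
   cardinality kappa, kappa^+, lambda, lambda^+.  A function on [kappa^+]^2
   is represented by a function on all subsets of Kp (only its values on
   2-element subsets matter). *)
Definition partition_rel (K Kp L Lp : Type) : Prop :=
  forall f : set Kp -> K, exists X : set Kp,
    X #= [set: Lp] /\ (f @` two_subsets X) #<= [set: L].

Definition tychonoff (T : topologicalType) : Prop :=
  accessible_space T /\
  forall (F : set T) (x : T), closed F -> ~ F x ->
    exists f : T -> R, continuous f /\ f x = 0%R /\ (forall y, F y -> f y = 1%R).

Record topGroup := TopGroup {
  tg_car : topologicalType;
  tg_mul : tg_car -> tg_car -> tg_car;
  tg_inv : tg_car -> tg_car;
  tg_one : tg_car;
  tg_mulA : forall x y z, tg_mul x (tg_mul y z) = tg_mul (tg_mul x y) z;
  tg_mul1 : forall x, tg_mul tg_one x = x /\ tg_mul x tg_one = x;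
  tg_mulV : forall x, tg_mul (tg_inv x) x = tg_one /\ tg_mul x (tg_inv x) = tg_one;
  tg_mul_cont : continuous (fun p : tg_car * tg_car => tg_mul p.1 p.2);
  tg_inv_cont : continuous tg_inv;
  tg_tych : tychonoff tg_car
}.

Definition is_base (T : topologicalType) (B : set (set T)) : Prop :=
  (forall b, B b -> open b) /\
  forall U : set T, open U -> forall x, U x -> exists b, B b /\ b x /\ b `<=` U.

Definition has_weight (T : topologicalType) (Theta : Type) : Prop :=
  (exists B : set (set T), is_base B /\ B #= [set: Theta]) /\
  forall B : set (set T), is_base B -> [set: Theta] #<= B.

Definition ltrans (T : Type) (mul : T -> T -> T) (g : T) (U : set T) : set T :=
  mul g @` U.

Definition aleph0_bounded (G : topGroup) : Prop :=
  forall U : set (tg_car G), open U -> U (tg_one G) ->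
    exists g : nat -> tg_car G,
      [set: tg_car G] `<=` \bigcup_n ltrans (@tg_mul G) (g n) U.

Definition rothberger_bounded (T : topologicalType) (mul : T -> T -> T)
    (e : T) (X : set T) : Prop :=
  forall U : nat -> set T, (forall n, open (U n) /\ U n e) ->
    exists g : nat -> T, X `<=` \bigcup_n ltrans mul (g n) (U n).

Definition BC (Theta : Type) : Prop :=
  forall G : topGroup, aleph0_bounded G -> has_weight (tg_car G) Theta ->
    forall X : set (tg_car G),
      rothberger_bounded (@tg_mul G) (tg_one G) X -> X #<= [set: Theta].

Notation cantor_group Theta := {ptws Theta -> bool}.

Definition cantor_add (Theta : Type) (f g : cantor_group Theta) : cantor_group Theta :=
  fun i => xorb (f i) (g i).

Definition cantor_zero (Theta : Type) : cantor_group Theta := fun _ => false.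

Definition BC_cantor (Theta : Type) : Prop :=
  forall X : set (cantor_group Theta),
    @rothberger_bounded (cantor_group Theta) (@cantor_add Theta) (@cantor_zero Theta) X ->
    X #<= [set: Theta].

(* Main.v *)
Require Import Defs.
From HB Require Import structures.
From mathcomp Require Import all_boot all_order all_algebra.
From mathcomp Require Import all_classical all_reals all_analysis.
From mathcomp Require Import Rstruct Rstruct_topology.
From Stdlib Require Import Rdefinitions.

(** Let [X] be a Rothberger bounded set of size at least kappa^+, and colour
    each pair from [X] with one of kappa many witnesses that its two points
    differ: a coordinate in the case of [2^kappa], a basic neighbourhood of the
    identity excluding [x^-1 y] in the case of a group of weight kappa.  The
    partition relation gives [Y] inside [X] of size lambda^+ on which lambda
    many witnesses suffice.  A continuous homomorphism that remembers these
    witnesses is injective on [Y], and the image of [Y] is Rothberger bounded, a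
    contradiction if the target falls under the hypothesis on lambda.

    For [2^kappa] the homomorphism is the projection to the chosen coordinates.
    In general, close the chosen neighbourhoods under "halving" and conjugation;
    by aleph_0-boundedness countably many new neighbourhoods take care of all
    conjugates of a given one.  The resulting lambda many neighbourhoods define
    a coarser group topology, whose Hausdorff quotient is aleph_0-bounded and of
    weight at most lambda.  Multiplying by [2^lambda] makes the weight exactly
    lambda. *)

Set Implicit Arguments.
Unset Strict Implicit.
Unset Printing Implicit Defensive.

Local Open Scope classical_set_scope.
Local Open Scope card_scope.

(** * Cardinal comparison *)

Definition embeds (T U : Type) : Prop := exists f : T -> U, injective f.

Lemma embeds_refl T : embeds T T.
Proof. by exists id. Qed.

Lemma embeds_trans U T V : embeds T U -> embeds U V -> embeds T V.
Proof. by move=> [f finj] [g ginj]; exists (g \o f); exact: inj_comp. Qed.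

Lemma embeds_prod T T' U U' :
  embeds T U -> embeds T' U' -> embeds (T * T') (U * U').
Proof.
move=> [f finj] [g ginj]; exists (fun p => (f p.1, g p.2)).
by move=> [a b] [c d] /= [/finj -> /ginj ->].
Qed.

Lemma embeds_set_val T (A : set T) : embeds A T.
Proof. by exists set_val; exact: val_inj. Qed.

Lemma card_le_embeds T U (A : set T) (B : set U) : A #<= B <-> embeds A B.
Proof.
split=> [/card_leP/injfunPex[f _ finj]|[f finj]].
  by exists f => x y; apply: finj; rewrite inE.
by apply/card_leP/injfunPex; exists f => // x y _ _; exact: finj.
Qed.

Lemma embeds_setT T : embeds T [set: T].
Proof. by exists (fun x => SigSub (mem_set (I : [set: T] x))) => x y []. Qed.

Lemma card_leT_embeds T U : [set: T] #<= [set: U] <-> embeds T U.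
Proof.
split=> [/card_le_embeds TU|TU]; last apply/card_le_embeds.
  exact: embeds_trans (embeds_setT T) (embeds_trans TU (embeds_set_val _)).
exact: embeds_trans (embeds_set_val _) (embeds_trans TU (embeds_setT U)).
Qed.

Lemma card_le_setT_embeds T (A : set T) U : A #<= [set: U] <-> embeds A U.
Proof.
split=> [/card_le_embeds TU|TU]; last apply/card_le_embeds.
  exact: embeds_trans TU (embeds_set_val _).
exact: embeds_trans TU (embeds_setT U).
Qed.

Lemma card_le_embeds_set T U (B : set U) : [set: T] #<= B <-> embeds T B.
Proof.
split=> [/card_le_embeds TU|TU]; last apply/card_le_embeds.
  exact: embeds_trans (embeds_setT T) TU.
exact: embeds_trans (embeds_set_val _) TU.
Qed.

Lemma embeds_setP T U (B : set U) :
  embeds T B <-> exists2 f : T -> U, injective f & forall x, B (f x).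
Proof.
split=> [[f finj]|[f finj fB]].
  by exists (set_val \o f) => [|x]; [exact: inj_comp val_inj finj|exact: set_valP].
by exists (fun x => SigSub (mem_set (fB x))) => x y [] /finj.
Qed.

Lemma infinite_embeds T : infinite_set [set: T] -> embeds nat T.
Proof. by move=> /infiniteP/card_leT_embeds. Qed.

Lemma embeds_total T U : embeds T U \/ embeds U T.
Proof.
pose P (G : set (T * U)) := forall p q, G p -> G q -> (p.1 = q.1 <-> p.2 = q.2).
have chainP F : F `<=` P -> total_on F subset -> P (\bigcup_(X in F) X).
  move=> FP Ftot p q [X FX Xp] [Y FY Yq].
  case: (Ftot _ _ FX FY) => sub.
    exact: (FP _ FY p q (sub _ Xp) Yq).
  exact: (FP _ FX p q Xp (sub _ Yq)).
have [G [GP Gmax]] := Zorn_bigcup chainP.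
have [/choice[f fG]|/existsNP[t tG]] := pselect (forall t, exists u, G (t, u)).
  by left; exists f => x y fxy; apply/(GP _ _ (fG x) (fG y)).
have [/choice[f fG]|/existsNP[u uG]] := pselect (forall u, exists t, G (t, u)).
  by right; exists f => x y fxy; apply/(GP _ _ (fG x) (fG y)).
exfalso; apply: (Gmax (G `|` [set (t, u)])).
  split; first by move=> p Gp; left.
  by move=> sub; apply: tG; exists u; apply: sub; right.
have sep p : G p -> p.1 <> t /\ p.2 <> u.
  by case: p => a b Gab; split=> /= e; [apply: tG; exists b|apply: uG; exists a];
    rewrite -e.
move=> p q [Gp|->] [Gq|->] //=; first exact: GP.
- by have [] := sep _ Gp.
- by have [] := sep _ Gq; split=> /esym.
Qed.

(** * Squares and finite sequences of an infinite set *)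

Section square.
Variable T : Type.
Hypothesis Tinf : embeds nat T.

Let dom (G : set (T * T * T)) : set T := [set a | exists b c, G (a, b, c)].

(* [G] is the graph of an injection of [S * S] into [S] for some infinite or
   empty [S]; the latter is there for the empty chain. *)
Let pairing (G : set (T * T * T)) :=
  [/\ forall p q, G p -> G q -> (p.1 = q.1 <-> p.2 = q.2),
      forall a b, dom G a -> dom G b -> exists c, G (a, b, c),
      forall a b c, G (a, b, c) -> dom G b /\ dom G c &
      forall p, G p -> embeds nat (dom G)].

Let embeds_sub (A B : set T) : A `<=` B -> embeds A B.
Proof.
move=> AB; apply/embeds_setP; exists set_val; first exact: val_inj.
by move=> x; apply: AB; exact: set_valP.
Qed.

Let pairing_chain F :
  F `<=` pairing -> total_on F subset -> pairing (\bigcup_(X in F) X).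
Proof.
move=> FP Ftot.
have domS X : F X -> dom X `<=` dom (\bigcup_(X in F) X).
  by move=> FX a [b [c Xabc]]; exists b, c, X.
split.
- move=> p q [X FX Xp] [Y FY Yq].
  have [sub|sub] := Ftot _ _ FX FY.
    by have [+ _ _ _] := FP _ FY; apply=> //; exact: sub.
  by have [+ _ _ _] := FP _ FX; apply=> //; exact: sub.
- move=> a b [b' [c' [X FX Xa]]] [b'' [c'' [Y FY Yb]]].
  have [sub|sub] := Ftot _ _ FX FY.
    have [_ /(_ a b)[] ] := FP _ FY; [by exists b', c'; exact: sub|by exists b'', c''|].
    by move=> c Yc; exists c, Y.
  have [_ /(_ a b)[] ] := FP _ FX; [by exists b', c'|by exists b'', c''; exact: sub|].
  by move=> c Yc; exists c, X.
- move=> a b c [X FX Xabc].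
  have [_ _ /(_ _ _ _ Xabc)[Xb Xc] _] := FP _ FX.
  by split; exact: domS FX _ _.
- move=> p [X FX Xp]; have [_ _ _ /(_ _ Xp) natX] := FP _ FX.
  by apply: embeds_trans natX (embeds_sub _); exact: domS.
Qed.

(** A countable pairing to start from; it keeps the maximal pairing from being empty. *)
Let pairing_nat : exists2 G, pairing G & G !=set0.
Proof.
have [f finj] := Tinf; pose e (p : nat * nat) := f (pickle p).
have einj : injective e by move=> p q /finj /(pcan_inj pickleK).
pose G : set (T * T * T) := [set x | exists p, x = (f p.1, f p.2, e p)].
have domG : dom G = range f.
  apply/seteqP; split=> a [i].
    by move=> [c [[j k] [-> _ _]]]; exists j.
  by move=> _ <-; exists (f i), (e (i, i)), (i, i).
exists G; last by exists (f 0%N, f 0%N, e (0%N, 0%N)), (0%N, 0%N).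
split; rewrite ?domG.
- move=> _ _ [[i j] ->] [[i' j'] ->] /=.
  by split=> [[/finj -> /finj ->]//|/einj[-> ->]].
- by move=> _ _ [i _ <-] [j _ <-]; exists (e (i, j)), (i, j).
- move=> a b c [[i j] [_ -> ->]]; split; first by exists j.
  by exists (pickle (i, j)).
- move=> _ _; apply/embeds_setP; exists f => // i; by exists i.
Qed.

(** Let [S] carry a maximal pairing. If the complement of [S] embeds in [S], then [T] embeds in
    [bool * S], hence in [S]. Otherwise the complement contains a copy of [S], and the pairing
    extends to the union of both. *)
Lemma embeds_square : embeds (T * T) T.
Proof.
have [M [MP Mmax]] := Zorn_bigcup pairing_chain.
have [p0 Mp0] : M !=set0.
  apply: contrapT => M0; have [G GP [p Gp]] := pairing_nat.
  apply: (Mmax G) => //; split; first by move=> q Mq; exfalso; apply: M0; exists q.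
  by move=> /(_ _ Gp) Mp; apply: M0; exists p.
have [Muniq Mtot Min /(_ _ Mp0) natS] := MP.
pose S := dom M.
have SS : embeds (S * S) S.
  have /choice[m mM] (p : S * S) : exists c, M (set_val p.1, set_val p.2, c).
    by apply: Mtot; exact: set_valP.
  apply/embeds_setP; exists m => [|p]; last by have [] := Min _ _ _ (mM p).
  move=> [a b] [c d] /(Muniq _ _ (mM _) (mM _))[].
  by move=> /val_inj -> /val_inj ->.
have bS : embeds (bool * S) S.
  have bnat : embeds bool nat by exists nat_of_bool => [[] []].
  apply: embeds_trans SS; apply: embeds_prod; last exact: embeds_refl.
  exact: embeds_trans bnat natS.
suff TS : embeds T S.
  apply: embeds_trans (embeds_prod TS TS) _.
  exact: embeds_trans SS (embeds_set_val _).
have [[h hinj]|/embeds_setP[h hinj hS]] := embeds_total (~` S) S.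
  apply: embeds_trans bS.
  exists (fun t => match pselect (S t) with
     | left St => (true, SigSub (mem_set St))
     | right nSt => (false, h (SigSub (mem_set (nSt : (~` S) t))))
     end).
  move=> x y; case: pselect => // Sx; case: pselect => // Sy; first by move=> [].
  by move=> -[/hinj[]].
exfalso.
have [k kinj] : embeds ((bool * S) * (bool * S)) S.
  exact: embeds_trans (embeds_prod bS bS) SS.
(* [d] identifies [bool * S] with the union of [S] and its disjoint copy under [h]. The graph [N]
   sends the pairs with a coordinate in the copy into the copy, away from the values of [M]. *)
pose d (p : bool * S) := if p.1 then h p.2 else set_val p.2.
have dinj : injective d.
  move=> [[] s] [[] t]; rewrite /d/=.
  - by move=> /hinj ->.
  - by move=> e; exfalso; apply: (hS s); rewrite e; exact: set_valP.
  - by move=> e; exfalso; apply: (hS t); rewrite -e; exact: set_valP.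
  - by move=> /val_inj ->.
pose N : set (T * T * T) := [set x | exists p q : bool * S,
  p.1 || q.1 /\ x = (d p, d q, h (k (p, q)))].
have dF s : S s -> exists2 p : bool * S, p.1 = false & d p = s.
  by move=> Ss; exists (false, SigSub (mem_set Ss)).
have domN : dom (M `|` N) = range d.
  apply/seteqP; split=> a.
    move=> [b [c [Mabc|[p [q [_ [-> _ _]]]]]]]; last by exists p.
    by have [|p _ <-] := dF a; [exists b, c|exists p].
  move=> [p _ <-]; have [s _] : exists s : S, True by have [f _] := natS; exists (f 0%N).
  exists (d (true, s)), (h (k (p, (true, s)))); right; exists p, (true, s).
  by rewrite orbT.
have MN p q : M p -> N q -> p.1 <> q.1 /\ p.2 <> q.2.
  move: p q => [[a b] c] [[a' b'] c'] Mabc [p [q [pq [-> -> ->]]]] /=; split.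
    move=> [ap bq].
    have [p' p'1 dp'] : exists2 p' : bool * S, p'.1 = false & d p' = a.
      by apply: dF; exists b, c.
    have [q' q'1 dq'] : exists2 p' : bool * S, p'.1 = false & d p' = b.
      by apply: dF; have [] := Min _ _ _ Mabc.
    move: pq; rewrite -(dinj p' p) ?dp'// -(dinj q' q) ?dq'//.
    by rewrite p'1 q'1.
  by move=> e; apply: (hS (k (p, q))); rewrite -e; have [] := Min _ _ _ Mabc.
apply: (Mmax (M `|` N)).
  split; first by move=> p Mp; left.
  move=> sub; have [f _] := natS; pose p := (true, f 0%N).
  have Np : N (d p, d p, h (k (p, p))) by exists p, p.
  by have [] := MN _ _ (sub _ (or_intror Np)) Np.
split; rewrite ?domN.
- move=> p q [Mp|Np] [Mq|Nq]; first exact: Muniq.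
  + by have [] := MN _ _ Mp Nq.
  + by have [] := MN _ _ Mq Np; split=> /esym.
  + move: Np Nq => [p1 [p2 [_ ->]]] [q1 [q2 [_ ->]]] /=.
    by split=> [[/dinj -> /dinj ->]|/hinj/kinj[-> ->]].
- move=> _ _ [p _ <-] [q _ <-]; have [pq|] := boolP (p.1 || q.1).
    by exists (h (k (p, q))); right; exists p, q.
  case: p q => -[] s [[] t]//= _.
  have [c Mc] := Mtot (set_val s) (set_val t) (set_valP s) (set_valP t).
  by exists c; left.
- move=> a b c [Mabc|[p [q [_ [_ -> ->]]]]].
    have [Sb Sc] := Min _ _ _ Mabc.
    by have [p _ <-] := dF _ Sb; have [q _ <-] := dF _ Sc; split; [exists p|exists q].
  by split; [exists q|exists (true, k (p, q))].
- move=> _ _; apply: embeds_trans natS _; apply/embeds_setP.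
  exists (fun s => d (false, s)) => [s t /dinj[]//|s]; by exists (false, s).
Qed.

(** The nested pairing alone does not determine where the list ends, so the length is recorded
    too. *)
Lemma embeds_seq : embeds (seq T) T.
Proof.
have [f finj] := embeds_square; have [n ninj] := Tinf.
pose e := foldr (fun x y => f (x, y)) (n 0%N).
apply: embeds_trans (embeds_trans (embeds_prod Tinf (embeds_refl T)) embeds_square).
exists (fun s => (size s, e s)).
elim=> [|x s IH] [|y t] //= [st /finj[-> est]].
by rewrite (IH t) // st est.
Qed.

End square.

(** * Successor cardinals and the partition relation *)

Lemma succ_card_embeds K Kp T : is_succ_card K Kp -> ~ embeds T K -> embeds Kp T.
Proof.
move=> [_ [_ minKp]] nTK; apply/card_leT_embeds; apply: minKp.
  by apply/card_leT_embeds; case: (embeds_total K T).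
by move/card_leT_embeds.
Qed.

Lemma embeds_image_inj T U (A : set T) (f : T -> U) :
  set_inj A f -> embeds A (f @` A).
Proof.
move=> finj; apply/embeds_setP; exists (f \o set_val) => [x y /finj|x].
  by rewrite !inE => /(_ (set_valP x) (set_valP y)) /val_inj.
by exists (set_val x) => //; exact: set_valP.
Qed.

Lemma embeds_range_cover (K L : Type) (k0 : K) (A : set K) :
  embeds A L -> exists s : L -> K, A `<=` range s.
Proof.
move=> [g ginj].
exists (fun l => match pselect (exists a, g a = l) with
                 | left e => set_val (projT1 (cid e))
                 | right _ => k0
                 end) => k Ak.
exists (g (SigSub (mem_set Ak))) => //.
case: pselect => [e|[]]; last by exists (SigSub (mem_set Ak)).
by case: cid => a /= /ginj ->.
Qed.

(** Here [sep x y k] reads as: [k] witnesses that [x] and [y] differ. It need not be symmetric, and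
    the colour of an unordered pair cannot tell the order, whence the disjunction. *)
Lemma partition_rel_separation (K L Kp Lp T : Type) (sep : T -> T -> K -> Prop)
    (X : set T) :
  infinite_set [set: K] -> is_succ_card K Kp -> is_succ_card L Lp ->
  partition_rel K Kp L Lp ->
  (forall x y, x <> y -> exists k, sep x y k) -> ~ (X #<= [set: K]) ->
  exists (s : L -> K) (Y : set T), [/\ Y `<=` X, ~ (Y #<= [set: L]) &
    forall x y, Y x -> Y y -> x <> y -> exists l, sep x y (s l) \/ sep y x (s l)].
Proof.
move=> /infinite_embeds[k0' _] succK succL part sepP nXK.
have {nXK} /embeds_setP[j jinj jX] : embeds Kp X.
  by apply: (succ_card_embeds succK) => XK; apply/nXK/card_le_setT_embeds.
(* The colouring: a pair gets a witness for one of its two orders, any other set a dummy colour. *)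
have /choice[f fP] (S : set Kp) : exists k, (exists u v, u <> v /\ S = [set u; v]) ->
    exists u v, S = [set u; v] /\ sep (j u) (j v) k.
  have [[u [v [uv ->]]]|nS] := pselect (exists u v, u <> v /\ S = [set u; v]).
    have [k juvk] : exists k, sep (j u) (j v) k by apply: sepP => /jinj.
    by exists k => _; exists u, v.
  by exists (k0' 0%N).
have [Z [ZLp fZL]] := part f.
have [s fZs] := embeds_range_cover (k0' 0%N) ((card_le_setT_embeds _ _).1 fZL).
exists s, (j @` Z); split.
- by move=> _ [u _ <-].
- move=> /card_le_setT_embeds jZL; have [_ [+ _]] := succL; apply.
  apply/card_leT_embeds; apply: embeds_trans jZL.
  have /card_le_embeds_set LpZ : [set: Lp] #<= Z.
    by move: ZLp; rewrite card_eq_le => /andP[].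
  by apply: embeds_trans LpZ (embeds_image_inj _) => u v _ _ /jinj.
- move=> _ _ [u Zu <-] [v Zv <-] juv.
  have uv : u <> v by move=> e; apply: juv; rewrite e.
  have [|l _ sl] := fZs (f [set u; v]).
    by exists [set u; v] => //; exists u, v.
  exists l; rewrite sl.
  have [|u' [v' [e sep']]] := fP [set u; v]; first by exists u, v.
  have : [set u; v] u' by rewrite e; left.
  have : [set u; v] v' by rewrite e; right.
  have : [set u'; v'] u by rewrite -e; left.
  have : [set u'; v'] v by rewrite -e; right.
  (* Equal unordered pairs match in one of two ways, the two sides of the disjunction; the remaining
     cases would give [u = v]. *)
  move=> vI uI [] /= v'E [] /= u'E; subst u' v'; [|by right|by left|].
    by case: vI => /= /esym.
  by case: uI.
Qed.

(** * Rothberger bounded sets and the Cantor groups *)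

(** Neighbourhoods are pulled back along [phi] and the translating elements pushed forward;
    continuity at the identity is enough. *)
Lemma rothberger_bounded_image (T T' : topologicalType) (mul : T -> T -> T) (e : T)
    (mul' : T' -> T' -> T') (e' : T') (phi : T -> T') (X : set T) :
  {morph phi : x y / mul x y >-> mul' x y} ->
  (forall U, open U -> U e' -> exists V, [/\ open V, V e & V `<=` phi @^-1` U]) ->
  rothberger_bounded mul e X -> rothberger_bounded mul' e' (phi @` X).
Proof.
move=> phiM phiC XR U UP.
have /choice[V VP] n : exists V, [/\ open V, V e & V `<=` phi @^-1` (U n)].
  by have [oU Ue] := UP n; exact: phiC.
have [n|g gX] := XR V; first by have [] := VP n.
exists (phi \o g) => _ [x /gX[n _ [v Vv <-]] <-].
exists n => //; exists (phi v); last by rewrite /= phiM.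
by have [_ _] := VP n; exact.
Qed.

Lemma rothberger_bounded_sub (T : topologicalType) (mul : T -> T -> T) (e : T)
    (X Y : set T) :
  Y `<=` X -> rothberger_bounded mul e X -> rothberger_bounded mul e Y.
Proof.
by move=> YX XR U UP; have [g gX] := XR U UP; exists g; exact: subset_trans gX.
Qed.

Lemma cantor_proj_continuous (K : Type) (k : K) :
  continuous ((fun f => f k) : cantor_group K -> bool).
Proof. exact: (@proj_continuous {classic K} (fun _ => bool) k). Qed.

Lemma cantor_comp_continuous (K L : Type) (s : L -> K) :
  continuous ((fun f => f \o s) : cantor_group K -> cantor_group L).
Proof.
move=> f; apply/cvg_sup => l; move: f.
apply/(@continuousP _ (initial_topology (fun f : L -> bool => f l))) => _ [B Bo <-].
have -> : ((fun f : cantor_group K => f \o s) @^-1`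
    ((fun f : cantor_group L => f l) @^-1` B)) =
  (fun f : cantor_group K => f (s l)) @^-1` B by [].
by apply: open_comp => // f _; exact: cantor_proj_continuous.
Qed.

Lemma BC_cantor_descent (K L Kp Lp : Type) :
  infinite_set [set: K] -> is_succ_card K Kp -> is_succ_card L Lp ->
  partition_rel K Kp L Lp -> BC_cantor L -> BC_cantor K.
Proof.
move=> Kinf succK succL part BCL X XR; apply: contrapT => nXK.
have [|s [Y [YX nYL Ysep]]] := partition_rel_separation
  (sep := fun (x y : cantor_group K) k => x k <> y k) Kinf succK succL part _ nXK.
  move=> x y xy; apply/existsNP => xyE; apply: xy.
  by apply/funext => k.
pose phi : cantor_group K -> cantor_group L := fun f => f \o s.
apply: nYL; apply/card_le_setT_embeds.
have /BCL/card_le_setT_embeds :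
    rothberger_bounded (@cantor_add L) (@cantor_zero L) (phi @` Y).
  apply: (rothberger_bounded_image _ _ (rothberger_bounded_sub YX XR)) => // U oU U0.
  exists (phi @^-1` U); split=> //.
  by apply: open_comp => // f _; exact: cantor_comp_continuous.
apply: embeds_trans; apply: embeds_image_inj => x y; rewrite !inE => Yx Yy pxy.
apply: contrapT => /(Ysep _ _ Yx Yy)[l sl].
have : x (s l) = y (s l) := congr1 (fun f => f l) pxy.
by case: sl => h e; exact: h.
Qed.

(** * The Hausdorff quotient for a group filter base *)

Section hausdorff_quotient.
Local Open Scope group_scope.

(** The neighbourhood axioms for the identity of a group topology, Hausdorff or not; the sets are
    not assumed open. *)
Record group_base (G : groupType) := GroupBase {
  gb_idx : Type;
  gb_nbh :> gb_idx -> set G;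
  gb_idx0 : gb_idx;
  gb_one : forall i, gb_nbh i 1;
  gb_meet : forall i j, exists k, gb_nbh k `<=` gb_nbh i `&` gb_nbh j;
  gb_div : forall i, exists j, forall x y,
    gb_nbh j x -> gb_nbh j y -> gb_nbh i (x^-1 * y);
  gb_conj : forall i g, exists j, forall x, gb_nbh j x -> gb_nbh i (x ^ g)
}.

Variables (G : groupType) (V : group_base G).

Lemma gb_inv i : exists j, forall x, V j x -> V i x^-1.
Proof.
have [j jP] := gb_div i; exists j => x jx.
by rewrite -(mulg1 x^-1); apply: jP => //; exact: gb_one.
Qed.

Lemma gb_mul i : exists j, forall x y, V j x -> V j y -> V i (x * y).
Proof.
have [k kP] := gb_div i; have [l lP] := gb_inv k.
have [j jP] := gb_meet k l; exists j => x y /jP[_ lx] /jP[ky _].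
by rewrite -(invgK x); apply: kP => //; exact: lP.
Qed.

(** Being in the same coset of the intersection of all [V i], the closure of the identity. *)
Definition gb_eqv (x y : G) : Prop := forall i, V i (x^-1 * y).

Lemma gb_eqv_refl x : gb_eqv x x.
Proof. by move=> i; rewrite mulVg; exact: gb_one. Qed.

Lemma gb_eqv_sym x y : gb_eqv x y -> gb_eqv y x.
Proof.
by move=> xy i; have [j jP] := gb_inv i; have := jP _ (xy j); rewrite !gnorm.
Qed.

Lemma gb_eqv_trans y x z : gb_eqv x y -> gb_eqv y z -> gb_eqv x z.
Proof.
by move=> xy yz i; have [j jP] := gb_mul i; have := jP _ _ (xy j) (yz j); rewrite !gnorm.
Qed.

Lemma gb_eqv_mul x x' y y' : gb_eqv x x' -> gb_eqv y y' -> gb_eqv (x * y) (x' * y').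
Proof.
move=> xx yy i; have [j jP] := gb_mul i; have [k kP] := gb_conj j y.
by have := jP _ _ (kP _ (xx k)) (yy j); rewrite /conjg; rewrite !gnorm.
Qed.

Lemma gb_eqv_inv x x' : gb_eqv x x' -> gb_eqv x^-1 x'^-1.
Proof.
move=> /gb_eqv_sym xx i; have [j jP] := gb_conj i x'^-1.
by have := jP _ (xx j); rewrite /conjg; rewrite !gnorm.
Qed.

Definition gb_quot : Type := {S : set G | exists x, S = gb_eqv x}.

Definition gb_pi (x : G) : gb_quot := exist _ (gb_eqv x) (ex_intro _ x erefl).

Lemma gb_piP x y : gb_pi x = gb_pi y <-> gb_eqv x y.
Proof.
split=> [[e]|xy]; first by rewrite e; exact: gb_eqv_refl.
apply/eq_exist/seteqP; split=> z.
  exact/gb_eqv_trans/gb_eqv_sym.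
exact: gb_eqv_trans.
Qed.

Definition gb_repr (q : gb_quot) : G := projT1 (cid (proj2_sig q)).

Lemma gb_reprK : cancel gb_repr gb_pi.
Proof.
move=> [S Sq]; rewrite /gb_repr; case: cid => x /= xq.
exact/eq_exist/esym.
Qed.

Lemma gb_pi_ind (P : gb_quot -> Prop) : (forall x, P (gb_pi x)) -> forall q, P q.
Proof. by move=> Ppi q; rewrite -(gb_reprK q). Qed.

Lemma gb_repr_pi x : gb_eqv (gb_repr (gb_pi x)) x.
Proof. by apply/gb_piP; rewrite gb_reprK. Qed.

Definition gb_quot_mul (p q : gb_quot) : gb_quot := gb_pi (gb_repr p * gb_repr q).
Definition gb_quot_inv (p : gb_quot) : gb_quot := gb_pi (gb_repr p)^-1.

Lemma gb_piM x y : gb_pi (x * y) = gb_quot_mul (gb_pi x) (gb_pi y).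
Proof.
by apply/gb_piP; apply: gb_eqv_mul; apply: gb_eqv_sym; exact: gb_repr_pi.
Qed.

Lemma gb_piV x : gb_pi x^-1 = gb_quot_inv (gb_pi x).
Proof. by apply/gb_piP; apply: gb_eqv_inv; apply: gb_eqv_sym; exact: gb_repr_pi. Qed.

(** The left uniformity. Uniform spaces are completely regular, so the Tychonoff property of the
    quotient reduces to T1. *)
Definition gb_ent : set_system (gb_quot * gb_quot) :=
  [set D | exists i, forall x y, V i (x^-1 * y) -> D (gb_pi x, gb_pi y)].

Lemma gb_ent_filter : Filter gb_ent.
Proof.
split.
- by exists (gb_idx0 V).
- move=> A B [i iA] [j jB]; have [k kP] := gb_meet i j.
  by exists k => x y /kP[ix jx]; split; [exact: iA|exact: jB].
- by move=> A B AB [i iA]; exists i => x y /iA /AB.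
Qed.

Lemma gb_ent_diagonal A : gb_ent A -> diagonal `<=` A.
Proof.
move=> [i iA] [p q] pq; have {pq} -> : p = q := pq; elim/gb_pi_ind: q => x.
by apply: iA; rewrite mulVg; exact: gb_one.
Qed.

Local Open Scope relation_scope.

Lemma gb_ent_inv A : gb_ent A -> gb_ent (A^-1).
Proof.
move=> [i iA]; have [j jP] := gb_inv i; exists j => x y /jP Vxy.
by apply: iA; move: Vxy; rewrite !gnorm.
Qed.

Lemma gb_ent_split A : gb_ent A -> exists2 B, gb_ent B & B \; B `<=` A.
Proof.
(* The middle point has two representatives [y] and [y'], so three factors [x^-1 * y], [y^-1 * y']
   and [y'^-1 * z] are multiplied, which takes two halvings. *)
move=> [i iA]; have [j jP] := gb_mul i; have [k kP] := gb_mul j.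
have [l lP] := gb_meet j k.
exists [set pq | exists x y, V l (x^-1 * y)%g /\ pq = (gb_pi x, gb_pi y)].
  by exists l => x y Vxy; exists x, y.
move=> [p r] /= [q [x [y [/lP[jxy _] [-> qy]]]]] [y' [z [/lP[_ kyz] [qy' ->]]]].
apply: iA.
have /(_ k) kyy : gb_eqv y y' by apply/gb_piP; rewrite -qy -qy'.
by have := jP _ _ jxy (kP _ _ kyy kyz); rewrite !gnorm.
Qed.

Local Close Scope relation_scope.

HB.instance Definition _ := gen_eqMixin gb_quot.
HB.instance Definition _ := gen_choiceMixin gb_quot.
HB.instance Definition _ := isUniform.Build gb_quot
  gb_ent_filter gb_ent_diagonal gb_ent_inv gb_ent_split.

Lemma gb_nbhsP x (A : set gb_quot) :
  nbhs (gb_pi x) A <-> exists i, forall v, V i v -> A (gb_pi (x * v)).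
Proof.
rewrite -filter_from_entourageE; split.
  move=> [E [i iE] EA]; exists i => v Vv; apply: EA; apply/xsectionP.
  by apply: iE; rewrite !gnorm.
move=> [i iA]; have [j jP] := gb_mul i.
(* The section of this relation at [gb_pi x] is [A]; at every other point it is the whole
   quotient. *)
exists [set pq | pq.1 = gb_pi x -> A pq.2]; last first.
  by move=> q /xsectionP /=; exact.
exists j => y z Vyz /= /esym/gb_piP/(_ j) Vxy.
by have := iA _ (jP _ _ Vxy Vyz); rewrite !gnorm.
Qed.

Lemma gb_mul_continuous :
  continuous (fun p : gb_quot * gb_quot => gb_quot_mul p.1 p.2).
Proof.
move=> [p q]; elim/gb_pi_ind: p => x; elim/gb_pi_ind: q => y A /=.
rewrite -gb_piM => /gb_nbhsP[i iA].
(* Rests on [(x * v) * (y * w) = (x * y) * (v ^ y * w)]. *)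
have [j jP] := gb_mul i; have [k kP] := gb_conj j y.
exists ([set r | exists2 v, V k v & r = gb_pi (x * v)],
        [set r | exists2 v, V j v & r = gb_pi (y * v)]).
  by split; apply/gb_nbhsP; [exists k|exists j] => v Vv; exists v.
move=> [_ _] /= [[v Vv ->] [w Vw ->]]; rewrite /= -gb_piM.
by have := iA _ (jP _ _ (kP _ Vv) Vw); rewrite /conjg; rewrite !gnorm.
Qed.

Lemma gb_inv_continuous : continuous gb_quot_inv.
Proof.
move=> p; elim/gb_pi_ind: p => x A; rewrite -gb_piV => /gb_nbhsP[i iA].
have [j jP] := gb_conj i x^-1; have [k kP] := gb_inv j.
apply/gb_nbhsP; exists k => v Vv /=; rewrite -gb_piV.
by have := iA _ (jP _ (kP _ Vv)); rewrite /conjg; rewrite !gnorm.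
Qed.

Lemma gb_tychonoff : Defs.tychonoff gb_quot.
Proof.
split.
  move=> p q /eqP; elim/gb_pi_ind: p => x; elim/gb_pi_ind: q => y.
  move=> xy; have {xy} [i nVi] : exists i, ~ V i (x^-1 * y).
    by apply/existsNP => xyV; apply: xy; exact/gb_piP.
  exists (interior (~` [set gb_pi y])); split; first exact: open_interior.
    apply/mem_set/gb_nbhsP; have [j jP] := gb_mul i.
    exists j => v Vv /= /gb_piP/(_ j) Vxy; apply: nVi.
    by have := jP _ _ Vv Vxy; rewrite !gnorm.
  by apply/mem_set => /interior_subset /(_ erefl).
move=> F x clF nFx.
have [f [fc _ f0 f1]] := (@uniform_separatorP _ R _ _).1
  (uniform_completely_regular (R := R) clF nFx).
exists f; split => //; split; first by apply: f0; exists x.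
by move=> y Fy; apply: f1; exists y.
Qed.

Lemma gb_quot_mulA p q r :
  gb_quot_mul p (gb_quot_mul q r) = gb_quot_mul (gb_quot_mul p q) r.
Proof.
elim/gb_pi_ind: p => x; elim/gb_pi_ind: q => y; elim/gb_pi_ind: r => z.
by rewrite -!gb_piM mulgA.
Qed.

Lemma gb_quot_mul1 p : gb_quot_mul (gb_pi 1) p = p /\ gb_quot_mul p (gb_pi 1) = p.
Proof. by elim/gb_pi_ind: p => x; rewrite -!gb_piM mul1g mulg1. Qed.

Lemma gb_quot_mulV p :
  gb_quot_mul (gb_quot_inv p) p = gb_pi 1 /\ gb_quot_mul p (gb_quot_inv p) = gb_pi 1.
Proof. by elim/gb_pi_ind: p => x; rewrite -gb_piV -!gb_piM mulVg mulgV. Qed.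

Definition gb_topGroup : topGroup :=
  @TopGroup gb_quot gb_quot_mul gb_quot_inv (gb_pi 1) gb_quot_mulA gb_quot_mul1
    gb_quot_mulV gb_mul_continuous gb_inv_continuous gb_tychonoff.

Hypothesis V_cover : forall i, exists g : nat -> G,
  forall x, exists n, V i ((g n)^-1 * x).

Lemma gb_aleph0_bounded : aleph0_bounded gb_topGroup.
Proof.
move=> U /= oU U1; have /gb_nbhsP[i iU] := open_nbhs_nbhs (conj oU U1).
have [g gP] := V_cover i; exists (gb_pi \o g) => p _.
elim/gb_pi_ind: p => x; have [n Vn] := gP x; exists n => //.
exists (gb_pi ((g n)^-1 * x)); first by have := iU _ Vn; rewrite mul1g.
by rewrite /= -gb_piM; rewrite !gnorm.
Qed.

(** If [(g k n)^-1 * x] lies in a small enough [V k], the translate of [V j] by [g k n] is a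
    neighbourhood of [x] inside [x * V i]. Indexing the base by triples bounds the weight from
    above; interiors are taken because [V j] may not be open. *)
Lemma gb_base : exists (g : gb_idx V -> nat -> G),
  is_base (range (fun q : gb_idx V * nat * gb_idx V =>
    interior (gb_pi @` [set x | V q.2 ((g q.1.1 q.1.2)^-1 * x)]))).
Proof.
have /choice[g gP] := V_cover; exists g; split=> [_ [q _ <-]|U oU p].
  exact: open_interior.
elim/gb_pi_ind: p => x Ux; have /gb_nbhsP[i iU] := open_nbhs_nbhs (conj oU Ux).
have [j jP] := gb_div i; have [k kP] := gb_mul j.
have [n Vn] := gP k x.
exists (interior (gb_pi @` [set y | V j ((g k n)^-1 * y)])); split; [|split].
- by exists (k, n, j).
- apply/gb_nbhsP; exists k => v Vv; exists (x * v) => //=.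
  by have := kP _ _ Vn Vv; rewrite !gnorm.
- move=> _ /interior_subset [y /= Vy <-].
  have Vx : V j ((g k n)^-1 * x).
    by have := kP _ _ Vn (gb_one k); rewrite mulg1.
  by have := iU _ (jP _ _ Vx Vy); rewrite !gnorm.
Qed.

End hausdorff_quotient.

(** * Coarsening an aleph_0-bounded group to weight lambda *)

(* An alias of [tg_car G], to carry both its topology and MathComp's group
   structure. *)
Definition tg_group (G : topGroup) : Type := tg_car G.

HB.instance Definition _ (G : topGroup) :=
  Topological.copy (tg_group G) (tg_car G).
HB.instance Definition _ (G : topGroup) := @isGroup.Build (tg_group G)
  (tg_one G) (@tg_inv G) (@tg_mul G) (@tg_mulA G)
  (fun x => (tg_mul1 x).1) (fun x => (tg_mul1 x).2)
  (fun x => (tg_mulV x).1) (fun x => (tg_mulV x).2).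

(** The bare group [2^lambda]; its topology enters through the finite lists of coordinates in
    [coset_nbh]. *)
Definition bool_pow (L : Type) : Type := L -> bool.

Section bool_pow_group.
Variable L : Type.

Let add (f g : bool_pow L) : bool_pow L := fun l => f l (+) g l.
Let zero : bool_pow L := fun=> false.

Let addA : associative add.
Proof. by move=> f g h; apply/funext => l; exact: addbA. Qed.
Let add0 : left_id zero add.
Proof. by move=> f; apply/funext => l; exact: addFb. Qed.
Let addf0 : right_id zero add.
Proof. by move=> f; apply/funext => l; exact: addbF. Qed.
Let addff (f : bool_pow L) : add f f = zero.
Proof. by apply/funext => l; exact: addbb. Qed.

HB.instance Definition _ := Choice.copy (bool_pow L) (L -> bool).
HB.instance Definition _ := @isGroup.Build (bool_pow L)
  zero id add addA add0 addf0 addff addff.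

End bool_pow_group.

Section refinement.
Local Open Scope group_scope.
Variables (G : topGroup) (Gbounded : aleph0_bounded G).
Local Notation T := (tg_group G).

Definition unit_nbhd (U : set T) : Prop := open U /\ U 1.

Lemma tg_mul_continuous_comp (S : topologicalType) (a b : S -> T) :
  continuous a -> continuous b -> continuous (fun x => a x * b x).
Proof.
move=> ac bc x.
apply: (@continuous_comp _ _ _ (fun x => (a x, b x)) (fun p : T * T => p.1 * p.2)).
  by apply: cvg_pair; [exact: ac|exact: bc].
exact: (@tg_mul_cont G).
Qed.

Lemma tg_inv_continuous_comp (S : topologicalType) (a : S -> T) :
  continuous a -> continuous (fun x => (a x)^-1).
Proof.
by move=> ac x; apply: (@continuous_comp _ _ _ a); [exact: ac|exact: (@tg_inv_cont G)].
Qed.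

Lemma unit_nbhd2 (f : T * T -> T) (U : set T) :
  continuous f -> f (1, 1) = 1 -> unit_nbhd U ->
  exists2 W, unit_nbhd W & forall x y, W x -> W y -> U (f (x, y)).
Proof.
move=> fc f1 [oU U1].
have : nbhs (f (1, 1)) U by rewrite f1; exact: open_nbhs_nbhs.
move=> /fc[[A B] /= [A1 B1] AB]; exists (interior (A `&` B)).
  by split; [exact: open_interior|apply: filterI].
by move=> x y /interior_subset[Ax _] /interior_subset[_ By]; exact: (AB (x, y)).
Qed.

(* Countably many [S n] handle all conjugations: cover [G] by translates
   [g n * W] with [W ^ W] inside [U], and pull [W] back along conjugation by
   [g n]. *)
Lemma unit_nbhd_refine (U : set T) : exists S : nat -> set T, unit_nbhd U ->
  [/\ forall n, unit_nbhd (S n),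
      forall x y, S 0%N x -> S 0%N y -> U (x^-1 * y) &
      forall g, exists n, forall x, S n x -> U (x ^ g)].
Proof.
(* The value for other [U] is arbitrary; it makes [refine] a function on all sets. *)
have [Un|nU] := pselect (unit_nbhd U); last by exists (fun=> U).
have fstc : continuous (fst : T * T -> T) by move=> x; exact: cvg_fst.
have sndc : continuous (snd : T * T -> T) by move=> x; exact: cvg_snd.
have [D Dn DU] : exists2 W, unit_nbhd W & forall x y, W x -> W y -> U (x^-1 * y).
  apply: (@unit_nbhd2 (fun p => p.1^-1 * p.2)) => //; last by rewrite mulVg.
  by apply: tg_mul_continuous_comp => //; exact: tg_inv_continuous_comp.
have [W [oW W1] WU] : exists2 W, unit_nbhd W & forall x y, W x -> W y -> U (x ^ y).
  apply: (@unit_nbhd2 (fun p => p.1 ^ p.2)) => //; last by rewrite conj1g.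
  apply: tg_mul_continuous_comp; first exact: tg_inv_continuous_comp.
  exact: tg_mul_continuous_comp.
have [g gW] := Gbounded oW W1.
exists (fun n => if n is n.+1 then [set x | W (x ^ (g n : T))] else D) => _; split => //.
  move=> [//|n]; split; last by rewrite /= conj1g.
  apply: (@open_comp _ _ (fun x : T => x ^ (g n : T))) => // x _; move: x.
  apply: tg_mul_continuous_comp; first by move=> x; exact: cvg_cst.
  by apply: tg_mul_continuous_comp => x; [exact: cvg_id|exact: cvg_cst].
move=> h; have [n _ [w Ww wh]] := gW h I.
exists n.+1 => x /= Wx; have := WU _ _ Wx Ww.
by rewrite -conjgM -[h]wh.
Qed.

Definition refine : set T -> nat -> set T := projT1 (choice unit_nbhd_refine).

Lemma refineP U : unit_nbhd U ->
  [/\ forall n, unit_nbhd (refine U n),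
      forall x y, refine U 0 x -> refine U 0 y -> U (x^-1 * y) &
      forall g, exists n, forall x, refine U n x -> U (x ^ g)].
Proof. exact: projT2 (choice unit_nbhd_refine) U. Qed.

Variables (L : choiceType) (U : L -> set T).
Hypothesis U_nbhd : forall l, unit_nbhd (U l).

(* [subbase (l, s)] is obtained from [U l] by the refinements listed in [s],
   the last one first. *)
Definition subbase (i : L * seq nat) : set T := foldr (fun n S => refine S n) (U i.1) i.2.

Lemma subbase_nbhd i : unit_nbhd (subbase i).
Proof.
case: i => l; elim=> [|n s IH] /=; first exact: U_nbhd.
by have [+ _ _] := refineP IH; exact.
Qed.

(** Products of a finite intersection of subbasic sets with a basic neighbourhood of zero in
    [2^lambda]; the second factor keeps the weight from dropping below lambda. *)
Definition coset_nbh (j : seq (L * seq nat) * seq L) : set (T * bool_pow L) :=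
  [set x | {in j.1, forall i, subbase i x.1} /\ {in j.2, forall l, x.2 l = false}].

Lemma coset_nbh1 j : coset_nbh j 1.
Proof. by split=> // i _; have [] := subbase_nbhd i. Qed.

Lemma coset_nbhI i j : exists k, coset_nbh k `<=` coset_nbh i `&` coset_nbh j.
Proof.
exists (i.1 ++ j.1, i.2 ++ j.2) => x [/= x1 x2].
by split; split=> [k ki|k ki]; rewrite ?x2 ?mem_cat ?ki ?orbT //;
  apply: x1; rewrite mem_cat ki ?orbT.
Qed.

Lemma coset_nbh_div i : exists j, forall x y,
  coset_nbh j x -> coset_nbh j y -> coset_nbh i (x^-1 * y).
Proof.
(* Refinement number 0 is the one for division; vanishing on given coordinates already defines a
   subgroup, so the second list stays. *)
exists ([seq (k.1, 0%N :: k.2) | k <- i.1], i.2) => x y [/= x1 x2] [/= y1 y2].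
split=> [[l s] k1|l l2] /=.
  have [_ + _] := refineP (subbase_nbhd (l, s)); apply.
    by apply: (x1 (l, 0%N :: s)); apply/mapP; exists (l, s).
  by apply: (y1 (l, 0%N :: s)); apply/mapP; exists (l, s).
by rewrite -[RHS](addbb false) -{1}(x2 l l2) -(y2 l l2).
Qed.

Lemma coset_nbh_conj i g : exists j, forall x, coset_nbh j x -> coset_nbh i (x ^ g).
Proof.
have /choice[n nP] k :
    exists n, forall x, subbase (k.1, n :: k.2) x -> subbase k (x ^ g.1).
  by case: k => l s; have [_ _ /(_ g.1)] := refineP (subbase_nbhd (l, s)).
exists ([seq (k.1, n k :: k.2) | k <- i.1], i.2) => x [/= x1 x2].
split=> [k k1|l l2] /=; first by apply/nP/x1/mapP; exists k.
by rewrite -[LHS]/(g.2 l (+) (x.2 l (+) g.2 l)) x2 // addFb addbb.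
Qed.

Definition coset_base : group_base (T * bool_pow L)%type :=
  GroupBase ([::], [::]) coset_nbh1 coset_nbhI coset_nbh_div coset_nbh_conj.

Lemma subbase_finI_nbhd (p : seq (L * seq nat)) :
  unit_nbhd [set x | {in p, forall i, subbase i x}].
Proof.
split; last by move=> i _; have [] := subbase_nbhd i.
elim: p => [|i p IH].
  by rewrite (_ : [set _ | _] = setT); [exact: openT|apply/seteqP; split].
rewrite (_ : [set _ | _] = subbase i `&` [set x | {in p, forall i, subbase i x}]).
  by apply: openI => //; have [] := subbase_nbhd i.
apply/seteqP; split=> x.
  by move=> xP; split=> [|k kp]; apply: xP; rewrite inE ?eqxx ?kp ?orbT.
by move=> [xi xp] k; rewrite inE => /predU1P[->//|]; exact: xp.
Qed.

Lemma bool_pow_finite_cover (q : seq L) : exists e : nat -> bool_pow L,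
  forall x : bool_pow L, exists n, {in q, e n =1 x}.
Proof.
elim: q => [|l q [e eP]]; first by exists (fun=> 1) => x; exists 0%N.
(* The parity of [n] prescribes the value at [l], and [n./2] indexes the values on the rest of the
   list. *)
exists (fun n k => if k == l then odd n else e n./2 k) => x.
have [n en] := eP x; exists (x l + n.*2)%N => k.
rewrite inE oddD odd_double addbF oddb half_bit_double.
by have [->|_] := eqVneq k l => //= kq; exact: en.
Qed.

Lemma coset_base_cover j : exists g : nat -> T * bool_pow L,
  forall x, exists n, coset_base j ((g n)^-1 * x).
Proof.
have [oS S1] := subbase_finI_nbhd j.1.
have [g gS] := Gbounded oS S1; have [e eP] := bool_pow_finite_cover j.2.
(* One natural number codes the index of a translate in each factor; a number that codes no pair
   gives the identity. *)
exists (fun n => if unpickle n is Some (a, b) then (g a : T, e b) else (1, 1)) => x.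
have [a _ [w Sw wx]] := gS x.1 I; have [b bx] := eP x.2.
exists (pickle (a, b)); rewrite pickleK; split=> [i i1|l l2] /=.
  by rewrite -[x.1]wx [_ * _](@mulKg T (g a) w); exact: Sw.
by rewrite -[LHS]/(e b l (+) x.2 l) bx // addbb.
Qed.

Definition to_quot (x : T) : gb_quot coset_base := gb_pi coset_base (x, 1).

Lemma to_quotM : {morph to_quot : x y / x * y >-> gb_quot_mul x y}.
Proof.
by move=> x y; rewrite /to_quot -gb_piM; congr gb_pi; congr pair; rewrite mulg1.
Qed.

Lemma to_quot_separates x y l : to_quot x = to_quot y -> U l (x^-1 * y).
Proof.
(* With the empty list of refinements, the subbasic set is [U l] itself. *)
move=> /gb_piP/(_ ([:: (l, [::])], [::]))[/= /(_ (l, [::])) + _].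
by apply; rewrite inE.
Qed.

Lemma to_quot_continuous1 (O : set (gb_quot coset_base)) :
  open O -> O (gb_pi coset_base 1) -> exists V : set T,
  [/\ open V, V 1 & V `<=` to_quot @^-1` O].
Proof.
move=> oO O1; have /gb_nbhsP[j jO] := open_nbhs_nbhs (conj oO O1).
have [oS S1] := subbase_finI_nbhd j.1.
exists [set x | {in j.1, forall i, subbase i x}]; split => // x xj.
have : coset_base j (x, 1) by split.
by move=> /jO; rewrite mul1g.
Qed.

Hypothesis Linf : embeds nat L.

(** The domain indexes the base provided by [gb_base], so the weight is at most lambda. *)
Lemma embeds_coset_idx :
  embeds (seq (L * seq nat) * seq L * nat * (seq (L * seq nat) * seq L)) L.
Proof.
have LL := embeds_square Linf.
have seqL := embeds_seq Linf.
have Lseq : embeds (L * seq nat) L.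
  apply: (embeds_trans _ LL); apply: embeds_prod (embeds_refl _) _.
  by apply: embeds_trans Linf; exists pickle; exact: (pcan_inj pickleK).
have seqLseq : embeds (seq (L * seq nat)) L.
  apply: embeds_trans seqL; have [f finj] := Lseq.
  by exists (map f); exact: inj_map.
have J : embeds (seq (L * seq nat) * seq L) L.
  exact: embeds_trans (embeds_prod seqLseq seqL) LL.
apply: (embeds_trans _ LL); apply: (embeds_prod _ J).
exact: embeds_trans (embeds_prod J Linf) LL.
Qed.

(* Choose a basic set [b l] around the identity inside [{x | x.2 l = false}].
   A given open set lies in only finitely many of these, so [b] is
   finite-to-one. *)
Lemma embeds_coset_base_weight (B : set (set (gb_quot coset_base))) :
  is_base B -> embeds L B.
Proof.
move=> [Bo Bbase].
pose O (l : L) := gb_pi coset_base @` [set x | x.2 l = false].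
have /choice[b bP] l : exists S, [/\ B S, S (gb_pi coset_base 1) & S `<=` O l].
  have [|S [BS [S1 SO]]] := Bbase _ (@open_interior _ (O l)) (gb_pi coset_base 1).
    apply/gb_nbhsP; exists ([::], [:: l]) => v [_ /= v2]; exists v.
      by apply: v2; rewrite inE.
    by rewrite mul1g.
  by exists S; split=> // p /SO/interior_subset.
have /choice[q qP] S : exists q : seq L, open S -> S (gb_pi coset_base 1) ->
    forall v : bool_pow L, {in q, forall l, v l = false} -> S (gb_pi coset_base (1, v)).
  have [[oS S1]|nS] := pselect (open S /\ S (gb_pi coset_base 1)); last first.
    by exists [::] => oS S1; case: nS.
  have /gb_nbhsP[j jS] := open_nbhs_nbhs (conj oS S1).
  exists j.2 => _ _ v vj; have /jS : coset_base j (1, v).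
    by split=> // i _; have [] := subbase_nbhd i.
  by rewrite mul1g.
have lq l : l \in q (b l).
  apply: contrapT => /negP lnq; have [Bb b1 bO] := bP l.
  (* The test point is true only at [l]: it vanishes on [q (b l)], so its class lies in [b l], but
     not in [O l]. *)
  have /(qP _ (Bo _ Bb) b1)/bO[x /= xl] : {in q (b l), forall k, (k == l) = false}.
    by move=> k kq; apply/eqP => e; move: lnq; rewrite -{1}e kq.
  move=> /gb_piP/(_ ([::], [:: l]))[_ /= /(_ l)].
  rewrite inE eqxx => /(_ isT).
  by rewrite -[X in X = _]/(x.2 l (+) (l == l)) xl eqxx.
have bB l : B (b l) by have [] := bP l.
(* [l] is recovered from [b l] and its position in the finite list [q (b l)]. *)
have LB : embeds L (B * nat).
  exists (fun l => (SigSub (mem_set (bB l)), index l (q (b l)))).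
  by move=> l l' [bE]; rewrite -{1}bE; apply: index_inj; rewrite // bE.
have [natB|nnatB] := pselect (embeds nat B).
  apply: embeds_trans LB (embeds_trans _ (embeds_square natB)).
  exact: embeds_prod (embeds_refl _) natB.
exfalso.
have Bfin : finite_set B.
  by apply/finite_setPn => /card_le_embeds_set.
have : finite_set [set: L].
  apply: (@sub_finite_set _ _ (\bigcup_(S in B) [set` q S])).
    by move=> l _; exists (b l) => //=; exact: lq.
  by apply: bigcup_finite => // S _; exact: finite_seq.
by move=> /finite_setPn; apply; exact/card_leT_embeds.
Qed.

Lemma coset_base_weight : has_weight (gb_quot coset_base) L.
Proof.
have lower (B : set (set (gb_quot coset_base))) : is_base B -> [set: L] #<= B.
  by move=> Bbase; exact/card_le_embeds_set/embeds_coset_base_weight.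
split=> //; have [g gB] := gb_base coset_base_cover.
eexists; split; first exact: gB.
rewrite card_eq_le lower // andbT; apply: card_le_trans (card_image_le _ _) _.
exact/card_leT_embeds/embeds_coset_idx.
Qed.

End refinement.

(** * Descent for groups of weight kappa *)

Lemma BC_descent (K Kp Lp : Type) (L : choiceType) :
  infinite_set [set: K] -> infinite_set [set: L] ->
  is_succ_card K Kp -> is_succ_card L Lp ->
  partition_rel K Kp L Lp -> BC L -> BC K.
Proof.
move=> Kinf /infinite_embeds Linf succK succL part BCL G Gb [[B [[Bo Bbase] BK]] _] X XR.
apply: contrapT => nXK.
have /card_le_setT_embeds BleK : B #<= [set: K].
  by move: BK; rewrite card_eq_le => /andP[].
have [u uB] := embeds_range_cover (setT : set (tg_group G)) BleK.
(* A set [u k] that is not an open neighbourhood of the identity is replaced by the whole group, so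
   that every index gives one. *)
pose U (k : K) : set (tg_group G) := [set x | unit_nbhd (u k) -> u k x].
have Un k : unit_nbhd (U k).
  have [uk|nuk] := pselect (unit_nbhd (u k)).
    by rewrite (_ : U k = u k) //; apply/seteqP; split=> x; [exact|move=> ? _].
  rewrite (_ : U k = setT); first by split=> //; exact: openT.
  by apply/seteqP; split=> // x _ /nuk.
have [x y xy|s [Y [YX nYL Ysep]]] := partition_rel_separation
  (sep := fun (x y : tg_group G) k => ~ U k (x^-1 * y)%g) Kinf succK succL part _ nXK.
  have /eqP e1 : (1 : tg_group G)%g <> (x^-1 * y)%g.
    by move=> e; apply: xy; rewrite -[x]mulg1 e mulVKg.
  have [A [oA /set_mem A1 /set_mem Axy]] := (tg_tych G).1 _ _ e1.
  have [b [Bb [b1 bA]]] := Bbase A oA _ A1; have [k _ kb] := uB b Bb.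
  exists k => Uxy; apply/Axy/bA; rewrite -kb; apply: Uxy.
  by rewrite /unit_nbhd kb; split=> //; exact: Bo.
pose V := coset_base Gb (fun l => Un (s l)).
apply: nYL; apply/card_le_setT_embeds.
have /(BCL (gb_topGroup V))/card_le_setT_embeds :
    rothberger_bounded (@tg_mul (gb_topGroup V)) (tg_one (gb_topGroup V))
      (to_quot Gb (fun l => Un (s l)) @` Y).
  apply: (rothberger_bounded_image (to_quotM _ _) _ (rothberger_bounded_sub YX XR)).
  exact: to_quot_continuous1.
move=> /(_ (gb_aleph0_bounded (@coset_base_cover _ _ _ _ _))).
move=> /(_ (coset_base_weight _ _ Linf)).
apply: embeds_trans; apply: embeds_image_inj => x y; rewrite !inE => Yx Yy pxy.
apply: contrapT => /(Ysep _ _ Yx Yy)[l []]; apply.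
  exact: to_quot_separates pxy.
exact: to_quot_separates (esym pxy).
Qed.

Theorem theorem18 (K L Kp Lp : Type) :
  infinite_set [set: K] -> infinite_set [set: L] ->
  is_succ_card K Kp -> is_succ_card L Lp ->
  partition_rel K Kp L Lp ->
  (BC L -> BC K) /\ (BC_cantor L -> BC_cantor K).
Proof.
move=> Kinf Linf succK succL part; split; last exact: BC_cantor_descent succK succL part.
(* [{classic L}] supplies the decidable equality behind membership in lists over [L]. *)
exact: (@BC_descent K Kp Lp {classic L}).
Qed.
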